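(* The interval Shapley rule $Sh$ is the unique interval allocation rule for monotonic interval inventory situations that satisfies the Balanced Cost (BC) property.
   Context: A closed interval of reals is written $b=[\underline b,\overline b]$ with $\underline b\le\overline b$, its length is $|b|=\overline b-\underline b$, and $\mathcal I(\mathbb R)$ is the set of all closed intervals. Interval operations: $b+c=[\underline b+\underline c,\overline b+\overline c]$; $\beta b=[\beta\underline b,\beta\overline b]$ for $\beta\ge0$; for intervals of nonnegative reals $b^2=[\underline b^2,\overline b^2]$ and $\sqrt b=[\sqrt{\underline b},\sqrt{\overline b}]$; the subtraction $b-c=[\underline b-\underline c,\overline b-\overline c]$ is defined only if $|b|\ge|c|$. An interval inventory situation is a triple $(N,a,\{m_i\}_{i\in N})$ with $N$ a nonempty finite set of agents, $a>0$ a real number (the fixed ordering cost) and each $m_i=[\underline{m_i},\overline{m_i}]$ a closed interval of nonnegative reals (optimal number of orders per unit of time). For $S\subseteq N$ put $m_S=\sqrt{\sum_{i\in S}m_i^2}=[\underline{m_S},\overline{m_S}]$ (with $m_\emptyset=[0,0]$). Throughout, interval inventory situations are assumed to satisfy the standing condition $$\max_{i\in N}\left\{\underline{m_i^2}\cdot\frac{1}{\overline{m_i}^2}\right\}\le\underline{m_N}\cdot\frac{1}{\overline{m_N}}.$$ Such a situation is called monotonic if $|m_S|\le|m_T|$ for all $S\subseteq T\subseteq N$. The associated interval inventory game is $w^I(S)=2a\,m_S=[\underline{w^I}(S),\overline{w^I}(S)]$ for $S\subseteq N$, with $\underline{w^I}(S)=2a\sqrt{\sum_{i\in S}\underline{m_i}^2}$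 and $\overline{w^I}(S)=2a\sqrt{\sum_{i\in S}\overline{m_i}^2}$. The interval Shapley rule assigns to a monotonic interval inventory situation the interval Shapley value of $(N,w^I)$, i.e. with $n=|N|$, $$Sh_j(N,a,\{m_i\}_{i\in N})=\frac1{n!}\sum_{\sigma}\left(w^I(P^\sigma(j)\cup\{j\})-w^I(P^\sigma(j))\right),\quad j\in N,$$ where $\sigma$ runs over all orderings of $N$ and $P^\sigma(j)$ is the set of agents preceding $j$ in $\sigma$. Equivalently $Sh_j(N,a,\{m_i\}_{i\in N})=[\phi_j(N,\underline{w^I}),\phi_j(N,\overline{w^I})]$, where for a real-valued game $c:2^N\to\mathbb R$ with $c(\emptyset)=0$ the Shapley value is $\phi_j(N,c)=\sum_{S\subseteq N\setminus\{j\}}\frac{|S|!\,(n-|S|-1)!}{n!}[c(S\cup\{j\})-c(S)]$. An interval allocation rule is a map $\Psi$ assigning to each situation $(N,a,\{m_i\}_{i\in N})$ under consideration a vector in $\mathcal I(\mathbb R)^N$ with $\sum_{i\in N}\Psi_i(N,a,\{m_l\}_{l\in N})=2a\sqrt{\sum_{i\in N}m_i^2}$. Balanced Cost (BC): for any $(N,a,\{m_l\}_{l\in N})$ and any $i,j\in N$, $$\underline{\Psi_i(N,a,\{m_l\}_{l\in N})}-\underline{\Psi_i(N\setminus\{j\},a,\{m_l\}_{l\in N\setminus\{j\}})}=\underline{\Psi_j(N,a,\{m_l\}_{l\in N})}-\underline{\Psi_j(N\setminus\{i\},a,\{m_l\}_{l\in N\setminus\{i\}})}$$ and $$\overline{\Psi_i(N,a,\{m_l\}_{l\in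 N})}-\overline{\Psi_i(N\setminus\{j\},a,\{m_l\}_{l\in N\setminus\{j\}})}=\overline{\Psi_j(N,a,\{m_l\}_{l\in N})}-\overline{\Psi_j(N\setminus\{i\},a,\{m_l\}_{l\in N\setminus\{i\}})}.$$ *)

(* Defs.v *)
From HB Require Import structures.
From mathcomp Require Import all_boot all_order all_algebra.
From mathcomp Require Import finmap reals.
From mathcomp Require Import ring lra.

Set Implicit Arguments.
Unset Strict Implicit.
Unset Printing Implicit Defensive.

Import Order.TTheory GRing.Theory Num.Theory.

Local Open Scope fset_scope.
Local Open Scope ring_scope.

Record cinterval (R : realType) : Type := CInterval {
  lo : R;
  hi : R;
  lo_le_hi : lo <= hi }.

Lemma cinterval_eq (R : realType) (b c : cinterval R) :
  lo b = lo c -> hi b = hi c -> b = c.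
Proof.
case: b c => [bl bh bP] [cl ch cP] /= el eh.
by move: bP cP; rewrite el eh => bP cP; rewrite (bool_irrelevance bP cP).
Qed.

Definition ilen (R : realType) (b : cinterval R) : R := hi b - lo b.

Definition izero (R : realType) : cinterval R := CInterval (lexx (0 : R)).

Definition iadd (R : realType) (b c : cinterval R) : cinterval R :=
  CInterval (lerD (lo_le_hi b) (lo_le_hi c)).

Lemma iaddA (R : realType) : associative (@iadd R).
Proof. by move=> b c d; apply: cinterval_eq; rewrite /= addrA. Qed.

Lemma iaddC (R : realType) : commutative (@iadd R).
Proof. by move=> b c; apply: cinterval_eq; rewrite /= addrC. Qed.

Lemma iadd0 (R : realType) : left_id (izero R) (@iadd R).
Proof. by move=> b; apply: cinterval_eq; rewrite /= add0r. Qed.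

HB.instance Definition _ (R : realType) :=
  Monoid.isComLaw.Build (cinterval R) (izero R) (@iadd R)
    (@iaddA R) (@iaddC R) (@iadd0 R).

Lemma lo_sum (R : realType) (I : finType) (P : pred I) (F : I -> cinterval R) :
  lo (\big[@iadd R/izero R]_(i | P i) F i) = \sum_(i | P i) lo (F i).
Proof. by apply: (big_morph (@lo R)). Qed.

Lemma hi_sum (R : realType) (I : finType) (P : pred I) (F : I -> cinterval R) :
  hi (\big[@iadd R/izero R]_(i | P i) F i) = \sum_(i | P i) hi (F i).
Proof. by apply: (big_morph (@hi R)). Qed.

(* The partial operations take a proof that their arguments are admissible. *)

Definition iscale (R : realType) (beta : R) (beta0 : 0 <= beta)
    (b : cinterval R) : cinterval R :=
  CInterval (ler_wpM2l beta0 (lo_le_hi b)).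

Lemma isqr_subproof (R : realType) (b : cinterval R) :
  0 <= lo b -> lo b ^+ 2 <= hi b ^+ 2.
Proof.
by move=> b0; have bh := lo_le_hi b; rewrite ler_pXn2r // nnegrE (le_trans b0).
Qed.

Definition isqr (R : realType) (b : cinterval R) (b0 : 0 <= lo b) :
  cinterval R := CInterval (isqr_subproof b0).

Definition isqrt (R : realType) (b : cinterval R) (b0 : 0 <= lo b) :
  cinterval R := CInterval (ler_wsqrtr (lo_le_hi b)).

Lemma isub_subproof (R : realType) (b c : cinterval R) :
  ilen c <= ilen b -> lo b - lo c <= hi b - hi c.
Proof. by rewrite /ilen => H; lra. Qed.

Definition isub (R : realType) (b c : cinterval R) (cb : ilen c <= ilen b) :
  cinterval R := CInterval (isub_subproof cb).

(* The agents form a finite subset of an arbitrary universe [U]; the intervals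
   are only given for the actual agents. *)
Record inventory_data (R : realType) (U : choiceType) : Type := InventoryData {
  agents : {fset U};
  cost : R;
  orders : agents -> cinterval R;
  agents_neq0 : agents != fset0;
  cost_gt0 : 0 < cost;
  orders_ge0 : [forall i, 0 <= lo (orders i)] }.

Lemma order_ge0 (R : realType) (U : choiceType) (s : inventory_data R U)
  (i : agents s) : 0 <= lo (orders i).
Proof. exact: (forallP (orders_ge0 s)). Qed.

Definition order_sqr (R : realType) (U : choiceType) (s : inventory_data R U)
  (i : agents s) : cinterval R := isqr (order_ge0 i).

Definition sum_sqr (R : realType) (U : choiceType) (s : inventory_data R U)
  (S : {set agents s}) : cinterval R :=
  \big[@iadd R/izero R]_(i in S) order_sqr i.

Lemma sum_sqr_ge0 (R : realType) (U : choiceType) (s : inventory_data R U)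
  (S : {set agents s}) : 0 <= lo (sum_sqr S).
Proof. by rewrite lo_sum sumr_ge0 // => i _; rewrite sqr_ge0. Qed.

Definition mS (R : realType) (U : choiceType) (s : inventory_data R U)
  (S : {set agents s}) : cinterval R := isqrt (sum_sqr_ge0 S).

(* All ratios are nonnegative, so the base value 0 does not affect the maximum.
   Since [x / 0 = 0], an agent whose interval is [0, 0] contributes the ratio 0,
   i.e. no constraint. *)
Definition standing_condition (R : realType) (U : choiceType)
    (s : inventory_data R U) : bool :=
  \big[Num.max/0]_(i : agents s) (lo (order_sqr i) * (hi (orders i) ^+ 2)^-1)
    <= lo (mS [set: agents s]) * (hi (mS [set: agents s]))^-1.

Record situation (R : realType) (U : choiceType) : Type := Situation {
  data :> inventory_data R U;
  standing : standing_condition data }.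

Definition monotonic (R : realType) (U : choiceType)
    (s : inventory_data R U) : bool :=
  [forall S : {set agents s}, [forall T : {set agents s},
    (S \subset T) ==> (ilen (mS S) <= ilen (mS T))]].

Record mono_situation (R : realType) (U : choiceType) : Type := MonoSituation {
  sit :> situation R U;
  mono : monotonic sit }.

Section Restriction.
Context (R : realType) (U : choiceType).

Lemma removed_neq0 (N : {fset U}) (i j : N) :
  i != j -> N `\ val j != fset0.
Proof.
move=> nij; apply/fset0Pn; exists (val i).
by rewrite in_fsetD1 (valP i) andbT.
Qed.

Lemma restricted_ge0 (s : inventory_data R U) (S : {fset U})
  (SN : S `<=` agents s) : [forall i : S, 0 <= lo (orders (fincl SN i))].
Proof. by apply/forallP => i; apply: order_ge0. Qed.

(* The situation without agent [j]; the other agent [i] witnesses that some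
   agent is left. *)
Definition remove_data (s : inventory_data R U) (i j : agents s)
    (nij : i != j) : inventory_data R U :=
  InventoryData (removed_neq0 nij) (cost_gt0 s)
    (restricted_ge0 (fsubD1set (agents s) (val j))).

Lemma mS_remove (s : inventory_data R U) (i j : agents s) (nij : i != j)
    (S : {set agents (remove_data nij)}) :
  mS S = mS (fincl (fsubD1set (agents s) (val j)) @: S).
Proof.
have injf := @fincl_inj _ _ _ (fsubD1set (agents s) (val j)).
apply: cinterval_eq; rewrite /= ?lo_sum ?hi_sum big_imset //=;
  by move=> x y _ _; apply: injf.
Qed.

Lemma monotonic_remove (s : inventory_data R U) (i j : agents s)
  (nij : i != j) : monotonic s -> monotonic (remove_data nij).
Proof.
move=> /forallP ms; apply/forallP => S; apply/forallP => T; apply/implyP => ST.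
rewrite !mS_remove; have /forallP/(_ (fincl (fsubD1set _ (val j)) @: T)) :=
  ms (fincl (fsubD1set _ (val j)) @: S).
by move/implyP; apply; apply: imsetS.
Qed.

Lemma ratio_le (p q p' q' : R) : 0 <= p' -> 0 <= q' -> p' <= p ->
  p <= q -> q' < q -> q' - p' <= q - p ->
  (p ^+ 2 - p' ^+ 2) * q <= p * (q ^+ 2 - q' ^+ 2).
Proof.
move=> p'0 q'0 p'p pq q'q mo; rewrite leNgt; apply/negP => H.
have p0 : 0 <= p by apply: le_trans p'p.
have q0 : 0 < q by apply: le_lt_trans q'q.
have h1 : p * (q + q') < (p + p') * q.
  rewrite -(ltr_pM2l (_ : 0 < q - q')) ?subr_gt0 //.
  have -> : (q - q') * (p * (q + q')) = p * (q ^+ 2 - q' ^+ 2) by ring.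
  apply: (lt_le_trans H).
  have -> : (p ^+ 2 - p' ^+ 2) * q = (p - p') * ((p + p') * q) by ring.
  apply: ler_wpM2r; last by lra.
  by rewrite mulr_ge0 ?addr_ge0 // ltW.
have h2 : p * q' <= p' * q by apply: ltW; move: h1; rewrite mulrDr mulrDl ltrD2l.
have h3 : (p * q') ^+ 2 <= (p' * q) ^+ 2.
  by rewrite ler_pXn2r // nnegrE mulr_ge0 // ltW.
have h4 : (p ^+ 2 - p' ^+ 2) * q * q <= p * (p * (q ^+ 2 - q' ^+ 2)).
  have -> : (p ^+ 2 - p' ^+ 2) * q * q = p ^+ 2 * q ^+ 2 - (p' * q) ^+ 2 by ring.
  have -> : p * (p * (q ^+ 2 - q' ^+ 2)) = p ^+ 2 * q ^+ 2 - (p * q') ^+ 2 by ring.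
  by lra.
have h5 : p * (p * (q ^+ 2 - q' ^+ 2)) <= q * (p * (q ^+ 2 - q' ^+ 2)).
  apply: ler_wpM2r => //; rewrite mulr_ge0 // subr_ge0 ler_pXn2r ?nnegrE //.
  - exact: ltW.
  - exact: ltW.
have := le_trans h4 h5; rewrite mulrC ler_pM2l //.
by rewrite leNgt H.
Qed.

(* Monotonicity implies the standing condition; hence removing an agent from a
   monotonic situation does not leave the class. *)
Lemma monotonic_standing (s : inventory_data R U) :
  monotonic s -> standing_condition s.
Proof.
move=> ms; set p := lo (mS [set: agents s]); set q := hi (mS [set: agents s]).
have p0 : 0 <= p by apply: sqrtr_ge0.
have pq : p <= q := lo_le_hi _.
rewrite /standing_condition -/p -/q.
have q0 : 0 <= q := le_trans p0 pq.
apply: bigmax_le => [|i _]; first by rewrite divr_ge0.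
set h := hi (orders i) ^+ 2; set l := lo (order_sqr i).
have l0 : 0 <= l by apply: sqr_ge0.
have h0 : 0 <= h by apply: sqr_ge0.
have [->|hn0] := eqVneq h 0; first by rewrite invr0 mulr0 divr_ge0.
have hp : 0 < h by rewrite lt_def hn0.
pose S := [set: agents s] :\ i; pose p' := lo (mS S); pose q' := hi (mS S).
have p'0 : 0 <= p' by apply: sqrtr_ge0.
have q'0 : 0 <= q' by apply: sqrtr_ge0.
have hiS0 (T : {set agents s}) : 0 <= hi (sum_sqr T).
  exact: le_trans (sum_sqr_ge0 T) (lo_le_hi _).
have el : p ^+ 2 = l + p' ^+ 2.
  by rewrite /p /p' /= !sqr_sqrtr ?sum_sqr_ge0 // !lo_sum (big_setD1 i) ?inE.
have eh : q ^+ 2 = h + q' ^+ 2.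
  by rewrite /q /q' /= !sqr_sqrtr // !hi_sum (big_setD1 i) ?inE.
have p'p : p' <= p by rewrite -(@ler_pXn2r _ 2) ?nnegrE // el lerDr.
have q'q : q' < q by rewrite -(@ltr_pXn2r _ 2) ?nnegrE // eh ltrDr.
have mo : q' - p' <= q - p.
  have /forallP/(_ S)/forallP/(_ [set: agents s]) := ms.
  by move/implyP; apply; apply: subsetT.
have := ratio_le p'0 q'0 p'p pq q'q mo.
rewrite el eh !addrK => Hr.
have qp : 0 < q by apply: le_lt_trans q'q.
by rewrite ler_pdivrMr // mulrAC ler_pdivlMr.
Qed.

Definition remove_situation (s : mono_situation R U) (i j : agents s)
    (nij : i != j) : situation R U :=
  Situation (monotonic_standing (monotonic_remove nij (mono s))).

Definition remove (s : mono_situation R U) (i j : agents s)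
    (nij : i != j) : mono_situation R U :=
  @MonoSituation _ _ (remove_situation nij) (monotonic_remove nij (mono s)).

Lemma kept_subproof (N : {fset U}) (i j : N) :
  i != j -> val i \in N `\ val j.
Proof. by move=> nij; rewrite in_fsetD1 (valP i) andbT. Qed.

(* [i], as an agent of the situation without [j]. *)
Definition kept (s : mono_situation R U) (i j : agents s) (nij : i != j) :
  agents (remove nij) := FSetSub (kept_subproof nij).

End Restriction.

Lemma scale_ge0 (R : realType) (U : choiceType) (s : inventory_data R U) :
  0 <= 2 * cost s.
Proof. by rewrite mulr_ge0 // ltW // cost_gt0. Qed.

Definition game (R : realType) (U : choiceType) (s : inventory_data R U)
  (S : {set agents s}) : cinterval R := iscale (scale_ge0 s) (mS S).

Lemma marginal_subproof (R : realType) (U : choiceType)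
    (s : mono_situation R U) (P : {set agents s}) (j : agents s) :
  ilen (game P) <= ilen (game (j |: P)).
Proof.
rewrite /ilen /= -!mulrBr; apply: ler_wpM2l; first exact: scale_ge0.
have /forallP/(_ P)/forallP/(_ (j |: P)) := mono s.
by move/implyP; apply; apply: subsetUr.
Qed.

Definition marginal (R : realType) (U : choiceType) (s : mono_situation R U)
  (P : {set agents s}) (j : agents s) : cinterval R :=
  isub (marginal_subproof P j).

Definition preceding (N : finType) (sigma : {ffun N -> 'I_#|N|}) (j : N) :
  {set N} := [set i | (sigma i < sigma j)%N].

Lemma invfact_ge0 (R : realType) (n : nat) : (0 : R) <= (n`!%:R)^-1.
Proof. by rewrite invr_ge0 ler0n. Qed.

(* An ordering of the agents is an injective (hence bijective) assignment
   [sigma] of positions to agents; by [marginal_subproof] the subtractions are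
   all defined. *)
Definition Sh (R : realType) (U : choiceType) (s : mono_situation R U)
  (j : agents s) : cinterval R :=
  iscale (invfact_ge0 R #|{: agents s}|)
    (\big[@iadd R/izero R]_(sigma : {ffun agents s -> 'I_#|{: agents s}|}
        | injectiveb sigma) marginal (preceding sigma j) j).

Arguments Sh {R U} s j.

Definition is_allocation_rule (R : realType) (U : choiceType)
    (Psi : forall s : mono_situation R U, agents s -> cinterval R) : Prop :=
  forall s : mono_situation R U,
    \big[@iadd R/izero R]_(i : agents s) Psi s i = game [set: agents s].

(* For [i = j] the equations would involve the payoff of an absent agent. *)
Definition balanced_cost (R : realType) (U : choiceType)
    (Psi : forall s : mono_situation R U, agents s -> cinterval R) : Prop :=
  forall (s : mono_situation R U) (i j : agents s)
         (nij : i != j) (nji : j != i),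
    lo (Psi s i) - lo (Psi (remove nij) (kept nij)) =
      lo (Psi s j) - lo (Psi (remove nji) (kept nji)) /\
    hi (Psi s i) - hi (Psi (remove nij) (kept nij)) =
      hi (Psi s j) - hi (Psi (remove nji) (kept nji)).

(* Main.v *)
Require Import Defs.
From mathcomp Require Import all_boot all_order all_algebra.
From mathcomp Require Import all_fingroup finmap reals ring lra.

(** The lower and the upper end points of the interval Shapley rule are the
    Shapley values of two real games, the lower and the upper end points of the
    interval inventory game, so the first two claims are facts about the Shapley
    value of a real game [v] with [v set0 = 0].

    Efficiency holds ordering by ordering: the marginal contributions of the
    agents along one ordering telescope to [v] of the grand coalition
    ([shapley_efficient]).

    For balanced contributions, the sum over orderings is grouped by the set [S]
    of agents that precede [j]. There are [s! (n - 1 - s)!] orderings for each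
    [S] with [s] elements ([card_orderings]), which gives the coefficient
    formula [shapleyE] with weights [w n s]. In the difference of the values of
    [i] and [j], a coalition [S] that contains neither of them contributes
    [(w n s + w n s.+1) * (v (i |: S) - v (j |: S))], and
    [w n s + w n s.+1 = w n.-1 s] ([weightS]). This is the weight of [S] in the
    games without [i] and without [j], so the difference of the two values is
    the same in the full game as between the two games with one agent less
    ([shapley_sub], [shapley_subgame], [shapley_balanced]).

    For uniqueness, the difference [d] of two rules with the balanced cost
    property is balanced as well and sums to zero in every situation. By
    induction on the number of agents [d] vanishes once an agent is removed;
    balance then makes [d] constant on the agents, and a constant with zero sum
    over a nonempty set is zero ([balanced_zero_sum_eq0]). *)

Set Implicit Arguments.
Unset Strict Implicit.
Unset Printing Implicit Defensive.

Import Order.TTheory GRing.Theory Num.Theory.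

Local Open Scope ring_scope.

(** * Orderings with a prescribed set of predecessors *)

Section Orderings.
Context (N : finType).
Implicit Types (sigma : {ffun N -> 'I_#|N|}) (S : {set N}).

Lemma preceding_notin sigma (j : N) : j \notin preceding sigma j.
Proof. by rewrite inE ltnn. Qed.

Lemma ordering_bij sigma : injective sigma -> bijective sigma.
Proof. by move=> inj; apply: inj_card_bij => //; rewrite card_ord. Qed.

(** The position of an agent is determined by the set of its predecessors; this
    makes any two orderings with the same predecessors of [j] put [j] at the same
    place. *)
Lemma card_preceding sigma (j : N) :
  injective sigma -> #|preceding sigma j| = sigma j.
Proof.
move=> inj; rewrite -(card_imset _ inj) -[RHS]card_ord.
have lejn : (sigma j <= #|N|)%N by apply: ltnW.
have winj : injective (widen_ord lejn) by move=> x y /(congr1 val) /= /val_inj.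
rewrite -[RHS](card_imset predT winj); apply: eq_card => k.
have [tau _ sK] := ordering_bij inj.
apply/imsetP/imsetP => [[i]|[i _ ->]].
  by rewrite inE => lt_ij ->; exists (Ordinal lt_ij) => //; apply: val_inj.
by exists (tau (widen_ord lejn i)); rewrite ?inE sK //=.
Qed.

(** List [S] first, then [j], then the remaining agents. *)
Lemma exists_ordering (j : N) S :
  j \notin S ->
  exists2 sigma : {ffun N -> 'I_#|N|}, injective sigma & preceding sigma j = S.
Proof.
move=> jS; pose e := enum S ++ j :: enum (~: (j |: S)).
have me x : x \in e.
  by rewrite mem_cat in_cons !mem_enum !inE; case: (x == j); case: (x \in S).
have ue : uniq e.
  rewrite cat_uniq /= !enum_uniq !mem_enum !inE eqxx /= (negPf jS) !andbT /=.
  by apply/hasPn => x; rewrite !mem_enum !inE negb_or => /andP[].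
have se : size e = #|N|.
  rewrite cardE; apply/eqP.
  by rewrite -uniq_size_uniq ?enum_uniq // => x; rewrite me mem_enum.
have lte x : (index x e < #|N|)%N by rewrite -se index_mem.
exists [ffun x => Ordinal (lte x)].
  move=> x y; rewrite !ffunE => /(congr1 val) /= exy.
  by rewrite -(nth_index j (me x)) exy nth_index.
apply/setP => x; rewrite inE !ffunE /= !index_cat !mem_enum (negPf jS) /= eqxx.
rewrite addn0.
case: ifPn => [xS|_]; first by rewrite index_mem mem_enum.
by rewrite ltnNge leq_addr.
Qed.

(** Together with its converse below, this identifies the permutations that fix
    [j] and preserve [S] with a product of two symmetric groups that meet
    trivially, so that they can be counted. *)
Lemma fixing_perm_Sym (j : N) S (p : {perm N}) :
    p j = j -> (forall x, (p x \in S) = (x \in S)) ->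
  p \in (Sym S * Sym (~: (j |: S)))%g.
Proof.
move=> pj pS; have Np : p \in 'N(S | 'P)%g.
  by apply/astabsP => x; rewrite /= apermE pS.
set r := restr_perm S p.
have Sr : perm_on S r by apply: restr_perm_on.
have SrV := perm_onV Sr.
rewrite -(mulKVg r p); apply: mem_mulg; rewrite inE //.
apply/subsetP => x; apply: contraR; rewrite !inE negbK permM => xjS.
case: (boolP (x \in S)) xjS => [xS _|xS]; last first.
  by rewrite orbF => /eqP xj; rewrite (out_perm SrV) // xj pj.
have rxS : r^-1%g x \in S by rewrite (perm_closed _ SrV).
by rewrite -(restr_permE Np rxS) permKV.
Qed.

Lemma Sym_fixing_perm (j : N) S (p : {perm N}) :
    j \notin S -> p \in (Sym S * Sym (~: (j |: S)))%g ->
  p j = j /\ forall x, (p x \in S) = (x \in S).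
Proof.
move=> jS /mulsgP[q r]; rewrite !inE => Sq Cr ->.
have rS x : x \in S -> r x = x.
  by move=> xS; rewrite (out_perm Cr) // !inE xS orbT.
split=> [|x]; first by rewrite permM (out_perm Sq) // (out_perm Cr) // !inE eqxx.
rewrite permM -[RHS](perm_closed _ Sq); apply/idP/idP => [rqS|/[dup] /rS -> //].
by have := rS _ rqS; move/perm_inj => qx; rewrite -qx.
Qed.

(** Fix one ordering in which [S] precedes [j]. The others with this property
    arise from it by permuting the agents so that [j] stays fixed and [S] is
    preserved, and distinct permutations give distinct orderings. *)
Lemma card_orderings (j : N) S : j \notin S ->
  #|[pred sigma : {ffun N -> 'I_#|N|} | injectiveb sigma
      & preceding sigma j == S]| = ((#|S|)`! * (#|N| - #|S|.+1)`!)%N.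
Proof.
move=> jS; have [sigma0 inj0 pre0] := exists_ordering jS.
have [tau s0K tauK] := ordering_bij inj0.
pose C := ~: (j |: S).
have cC : #|C| = (#|N| - #|S|.+1)%N.
  by rewrite -(cardsC (j |: S)) cardsU1 jS add1n addKn.
have tiSC : (Sym S :&: Sym C = 1)%g.
  apply/trivgP/subsetP => p; rewrite !inE => /andP[Sp Cp].
  apply/eqP/permP => x; rewrite perm1.
  have [xS|xS] := boolP (x \in S); last exact: out_perm Sp xS.
  by apply: out_perm Cp _; rewrite !inE xS orbT.
rewrite -cC -!card_Sym -(TI_cardMg tiSC).
pose act (p : {perm N}) : {ffun N -> 'I_#|N|} := [ffun x => sigma0 (p x)].
have act_inj : injective act.
  move=> p q /ffunP pq; apply/permP => x; apply: inj0.
  by have := pq x; rewrite !ffunE.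
rewrite -(card_imset _ act_inj); apply: eq_card => sigma; rewrite inE.
apply/andP/imsetP => [[/injectiveP inj /eqP pre]|
                      [p /(Sym_fixing_perm jS)[pj pS] ->]].
  have pinj : injective (fun x => tau (sigma x)).
    by move=> x y /(congr1 sigma0); rewrite !tauK; apply: inj.
  exists (perm pinj); last by apply/ffunP => x; rewrite ffunE permE tauK.
  have ej : sigma j = sigma0 j.
    by apply: val_inj; rewrite /= -!card_preceding // pre pre0.
  have sE x : (x \in S) = (sigma x < sigma0 j)%N by rewrite -pre inE ej.
  have s0E x : (x \in S) = (sigma0 x < sigma0 j)%N by rewrite -pre0 inE.
  apply: fixing_perm_Sym => [|x]; first by rewrite permE ej s0K.
  by rewrite permE s0E tauK -sE.
split; first by apply/injectiveP => x y; rewrite !ffunE => /inj0/perm_inj.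
apply/eqP/setP => x; rewrite inE !ffunE pj -[RHS]pS.
by rewrite -[in RHS]pre0 inE.
Qed.

End Orderings.

(** * The Shapley value of a real game *)

Section Shapley.
Context (R : realFieldType).

Definition shapley (N : finType) (v : {set N} -> R) (j : N) : R :=
  ((#|N|)`!%:R)^-1 * \sum_(sigma : {ffun N -> 'I_#|N|} | injectiveb sigma)
    (v (j |: preceding sigma j) - v (preceding sigma j)).

Definition weight (n k : nat) : R := (k`! * (n - k.+1)`!)%:R / n`!%:R.

Lemma shapleyE (N : finType) (v : {set N} -> R) (j : N) :
  shapley v j =
    \sum_(S : {set N} | j \notin S) weight #|N| #|S| * (v (j |: S) - v S).
Proof.
rewrite /shapley (partition_big (fun sigma => preceding sigma j)
  (fun S => j \notin S)) => [|sigma _]; last exact: preceding_notin.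
rewrite mulr_sumr; apply: eq_bigr => S jS.
rewrite (eq_bigr (fun=> v (j |: S) - v S)); last by move=> sigma /andP[_ /eqP->].
rewrite sumr_const (card_orderings jS) -(mulr_natl (v (j |: S) - v S)) mulrA.
by congr (_ * _); rewrite mulrC.
Qed.

(** In probabilistic terms: delete an agent [i] other than [j] from a uniformly
    random ordering. Then [j] has predecessors [S] in what is left exactly when
    it had [S] or [i |: S] before the deletion. *)
Lemma weightS (n k : nat) :
  (k.+1 < n)%N -> weight n k + weight n k.+1 = weight n.-1 k.
Proof.
move=> kn; have -> : n = (k + (n - k.+2)).+2 by rewrite -[LHS](subnKC kn).
move: (n - k.+2)%N => m {kn}; rewrite /weight succnK.
have -> : ((k + m).+2 - k.+1 = m.+1)%N by rewrite subSS -addnS addKn.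
have -> : ((k + m).+2 - k.+2 = m)%N by rewrite !subSS addKn.
have -> : ((k + m).+1 - k.+1 = m)%N by rewrite subSS addKn.
have f0 : (k + m).+1`!%:R != 0 :> R by rewrite pnatr_eq0 -lt0n fact_gt0.
have s0 : (k + m).+2%:R != 0 :> R by rewrite pnatr_eq0.
have eS : (k + m).+2%:R = k.+1%:R + m.+1%:R :> R by rewrite -natrD addnS.
rewrite (factS (k + m).+1) (factS k) (factS m).
move: ((k + m).+1)`! f0 => f f0; rewrite !natrM eS in s0 *.
by move: (k.+1%:R : R) (m.+1%:R : R) s0 => x y s0; field; rewrite f0 s0.
Qed.

(** Along one ordering the marginal contributions are the increments of [v] on
    the chain of its initial segments. *)
Lemma shapley_efficient (N : finType) (v : {set N} -> R) :
  v set0 = 0 -> \sum_(j : N) shapley v j = v [set: N].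
Proof.
move=> v0; rewrite -mulr_sumr exchange_big /=.
rewrite (eq_bigr (fun=> v [set: N])) => [|sigma /injectiveP inj].
  have -> : \sum_(sigma : {ffun N -> 'I_#|N|} | injectiveb sigma) v [set: N]
      = (#|N|)`!%:R * v [set: N].
    rewrite sumr_const mulr_natl; congr (_ *+ _).
    have := card_inj_ffuns N 'I_#|N|; rewrite card_ord ffactnn => <-.
    by rewrite cardsE.
  by rewrite mulKf // pnatr_eq0 -lt0n fact_gt0.
(* [u k] is the worth of the first [k] agents in the ordering [sigma]. *)
pose u k := v [set i | (sigma i < k)%N].
rewrite (eq_bigr (fun j => u (sigma j).+1 - u (sigma j))); last first.
  move=> j _; congr (v _ - _); apply/setP => i.
  by rewrite !inE [in RHS]ltnS [in RHS]leq_eqVlt -(inj_eq inj).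
have [tau sK tauK] := ordering_bij inj.
rewrite (reindex tau) /=; last by exists sigma => x _.
rewrite (eq_bigr (fun k : 'I_#|N| => u k.+1 - u k)); last first.
  by move=> k _; rewrite tauK.
rewrite -(big_mkord xpredT (fun k => u k.+1 - u k)) telescope_sumr //.
have -> : u #|N| = v [set: N] by congr v; apply/setP => i; rewrite !inE ltn_ord.
have -> : u 0%N = 0.
  by rewrite -v0; congr v; apply/setP => i; rewrite !inE ltn0.
by rewrite subr0.
Qed.

(** The game without [j] lives on a type of its own, embedded by [f] in the
    agents other than [j]. Its Shapley value is rewritten as a sum over coalitions
    of the full game, where subgames without different agents can be compared. *)
Lemma shapley_subgame (N N' : finType) (f : N' -> N) (j : N) (i : N')
    (v : {set N} -> R) :
    injective f -> (forall x, (x \in codom f) = (x != j)) ->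
  shapley (fun S : {set N'} => v (f @: S)) i =
    \sum_(S : {set N} | (f i \notin S) && (j \notin S))
      weight #|N|.-1 #|S| * (v (f i |: S) - v S).
Proof.
move=> finj fj; rewrite shapleyE.
have cN' : #|N'| = #|N|.-1.
  rewrite -(card_codom finj) -(cardsC1 j).
  by apply: eq_card => x; rewrite fj !inE.
have imK (S : {set N'}) : f @^-1: (f @: S) = S.
  by apply/setP => x; rewrite inE mem_imset.
rewrite (reindex_onto (fun S : {set N'} => f @: S) (fun S => f @^-1: S)) /=.
  apply: eq_big => [S|S _]; last by rewrite cN' card_imset // imsetU1.
  rewrite imK eqxx andbT mem_imset //; case: (i \notin S) => //=.
  apply/esym/imsetP => -[x _ ej]; have := fj j.
  by rewrite eqxx ej codom_f.
move=> S /andP[_ jS]; apply/setP => x; apply/imsetP/idP => [[y]|xS].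
  by rewrite inE => yS ->.
have /codomP[y xy] : x \in codom f by rewrite fj; apply: contraNneq jS => <-.
by exists y; rewrite ?inE -?xy.
Qed.

(** Pairing [S] with [S] enlarged by the other agent cancels all terms but
    those comparing [i |: S] with [j |: S]; the weights then add up as in
    [weightS]. *)
Lemma shapley_sub (N : finType) (v : {set N} -> R) (i j : N) : i != j ->
  shapley v i - shapley v j =
    \sum_(S : {set N} | (i \notin S) && (j \notin S))
      weight #|N|.-1 #|S| * (v (i |: S) - v (j |: S)).
Proof.
move=> nij.
have split_with (x y : N) : x != y -> shapley v x =
    \sum_(S : {set N} | (x \notin S) && (y \notin S))
      (weight #|N| #|S| * (v (x |: S) - v S) +
       weight #|N| #|S|.+1 * (v (x |: (y |: S)) - v (y |: S))).
  move=> nxy; rewrite shapleyE (bigID (fun S : {set N} => y \notin S)) /=.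
  rewrite big_split /=; congr (_ + _).
  rewrite (reindex_onto (fun S => y |: S) (fun S => S :\ y)) /=; last first.
    by move=> S /andP[_]; rewrite negbK => yS; rewrite setD1K.
  apply: eq_big => [S|S /andP[/andP[xS _] /eqP eS]].
    rewrite !inE (negPf nxy) eqxx /= andbT; congr (_ && _).
    apply/eqP/idP => [<-|yS]; first by rewrite !inE eqxx.
    by rewrite setU1K.
  by rewrite cardsU1 -[in y \in S]eS !inE eqxx.
rewrite (split_with i j) // (split_with j i) 1?eq_sym //.
rewrite [X in _ - X](eq_bigl (fun S : {set N} =>
  (i \notin S) && (j \notin S))); last by move=> S; rewrite andbC.
rewrite -sumrB; apply: eq_bigr => S /andP[iS jS].
rewrite -weightS; last first.
  have := max_card (mem (i |: (j |: S))).
  by rewrite cardsU1 !inE (negPf nij) (negPf iS) cardsU1 jS.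
by rewrite setUCA; ring.
Qed.

(** By [shapley_subgame] the terms with [v S] are common to both subgames, so
    the difference of the two subgame values is the right-hand side of
    [shapley_sub]. *)
Lemma shapley_balanced (N Ni Nj : finType) (fi : Ni -> N) (fj : Nj -> N)
    (i j : N) (i' : Nj) (j' : Ni) (v : {set N} -> R) :
    injective fi -> injective fj -> fj i' = i -> fi j' = j -> i != j ->
    (forall x, (x \in codom fi) = (x != i)) ->
    (forall x, (x \in codom fj) = (x != j)) ->
  shapley v i - shapley (fun S : {set Nj} => v (fj @: S)) i' =
  shapley v j - shapley (fun S : {set Ni} => v (fi @: S)) j'.
Proof.
move=> fiI fjI <- <- nij ci cj.
rewrite (shapley_subgame i' v fjI cj) (shapley_subgame j' v fiI ci).
rewrite [X in _ = _ - X](eq_bigl (fun S : {set N} =>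
  (fj i' \notin S) && (fi j' \notin S))); last by move=> S; rewrite andbC.
rewrite -[shapley v (fj i')](subrK (shapley v (fi j'))) shapley_sub //.
rewrite addrAC addrC -sumrB -sumrN; congr (_ + _); apply: eq_bigr => S _; ring.
Qed.
End Shapley.

(** * Balanced cost allocation in inventory situations *)

Section Rule.
Context (R : realType) (U : choiceType).
Implicit Types s : mono_situation R U.

Lemma lo_Sh s j : lo (Sh s j) = shapley (fun S => lo (game S)) j.
Proof. by rewrite /= lo_sum. Qed.

Lemma hi_Sh s j : hi (Sh s j) = shapley (fun S => hi (game S)) j.
Proof. by rewrite /= hi_sum. Qed.

Lemma game_set0 s : lo (game (set0 : {set agents s})) = 0 /\
  hi (game (set0 : {set agents s})) = 0.
Proof. by rewrite /= lo_sum hi_sum !big_set0 sqrtr0 mulr0. Qed.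

Lemma game_remove s (i j : agents s) (nij : i != j)
    (S : {set agents (remove nij)}) :
  game S = game (fincl (fsubD1set (agents s) (val j)) @: S).
Proof.
apply: cinterval_eq.
  exact: (congr1 (fun b => 2 * cost s * lo b) (@mS_remove R U s i j nij S)).
exact: (congr1 (fun b => 2 * cost s * hi b) (@mS_remove R U s i j nij S)).
Qed.

Lemma codom_fincl_fsetD1 (N : {fset U}) (j x : N) :
  (x \in codom (fincl (fsubD1set N (val j)))) = (x != j).
Proof.
apply/codomP/idP => [[y ->]|nxj].
  by rewrite -val_eqE /=; have := valP y; rewrite in_fsetD1 => /andP[].
by exists (FSetSub (kept_subproof nxj)); apply: val_inj.
Qed.

Lemma fincl_kept s (i j : agents s) (nij : i != j) :
  fincl (fsubD1set (agents s) (val j)) (kept nij) = i.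
Proof. exact: val_inj. Qed.

Lemma Sh_allocation : is_allocation_rule (@Sh R U).
Proof.
move=> s; have [lo0 hi0] := game_set0 s.
apply: cinterval_eq; rewrite ?lo_sum ?hi_sum.
  by under eq_bigr do rewrite lo_Sh; apply: shapley_efficient.
by under eq_bigr do rewrite hi_Sh; apply: shapley_efficient.
Qed.

Lemma Sh_balanced : balanced_cost (@Sh R U).
Proof.
move=> s i j nij nji.
have balanced (e : cinterval R -> R) :
    shapley (fun S => e (game S)) i
      - shapley (fun S : {set agents (remove nij)} => e (game S)) (kept nij) =
    shapley (fun S => e (game S)) j
      - shapley (fun S : {set agents (remove nji)} => e (game S)) (kept nji).
  have subgame (x y : agents s) (nxy : x != y) :
      shapley (fun S : {set agents (remove nxy)} => e (game S)) (kept nxy) =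
      shapley (fun S : {set agents (remove nxy)} =>
        e (game (fincl (fsubD1set (agents s) (val y)) @: S))) (kept nxy).
    by rewrite !shapleyE; apply: eq_bigr => S _; rewrite !game_remove.
  rewrite !subgame.
  have fI (k : agents s) := @fincl_inj _ _ _ (fsubD1set (agents s) (val k)).
  exact: (shapley_balanced (fun S => e (game S)) (fI i) (fI j)
    (fincl_kept nij) (fincl_kept nji) nij
    (codom_fincl_fsetD1 i) (codom_fincl_fsetD1 j)).
by rewrite !lo_Sh !hi_Sh !balanced.
Qed.

(** The uniqueness argument for one end point, applied to the difference of two
    rules. *)
Lemma balanced_zero_sum_eq0 (d : forall s, agents s -> R) :
    (forall s, \sum_(i : agents s) d s i = 0) ->
    (forall s (i j : agents s) (nij : i != j) (nji : j != i),
      d s i - d (remove nij) (kept nij) = d s j - d (remove nji) (kept nji)) ->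
  forall s i, d s i = 0.
Proof.
move=> d_sum d_bal s; have [n] := ubnP #|` agents s|.
elim: n => // n IHn in s *; rewrite ltnS => sn i.
have d_const j : d s j = d s i.
  have [->//|nji] := eqVneq j i; have nij : i != j by rewrite eq_sym.
  have small (x y : agents s) (nxy : x != y) : d (remove nxy) (kept nxy) = 0.
    apply: IHn; apply: leq_trans sn.
    by rewrite [X in (_ < X)%N](cardfsD1 (val y)) (valP y).
  by have := d_bal s j i nji nij; rewrite !small !subr0.
have := d_sum s; rewrite (eq_bigr (fun=> d s i)) // sumr_const => /eqP.
rewrite mulrn_eq0 => /orP[|/eqP//]; rewrite -[_ == _]negbK -lt0n.
by have -> : (0 < #|{: agents s}|)%N by apply/card_gt0P; exists i.
Qed.

End Rule.

Theorem theorem4p1 (R : realType) (U : choiceType) :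
  [/\ is_allocation_rule (@Sh R U),
      balanced_cost (@Sh R U)
    & forall Psi : forall s : mono_situation R U, agents s -> cinterval R,
        is_allocation_rule Psi -> balanced_cost Psi ->
        forall (s : mono_situation R U) (i : agents s), Psi s i = Sh s i].
Proof.
split; [exact: Sh_allocation | exact: Sh_balanced | move=> Psi allocP balP s i].
have allocS := @Sh_allocation R U; have balS := @Sh_balanced R U.
apply: cinterval_eq; apply/eqP; rewrite -subr_eq0; apply/eqP; move: s i.
  apply: balanced_zero_sum_eq0 => [s|s i j nij nji].
    by rewrite sumrB -!lo_sum allocP allocS subrr.
  have [bP _] := balP s i j nij nji; have [bS _] := balS s i j nij nji.
  lra.
apply: balanced_zero_sum_eq0 => [s|s i j nij nji].
  by rewrite sumrB -!hi_sum allocP allocS subrr.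
have [_ bP] := balP s i j nij nji; have [_ bS] := balS s i j nij nji.
lra.
Qed.
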